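(* Let $A,B$ be formulas of TCF. Write $F\in\mathcal T_{\vec C}$ for ''$F$ is tight relative to $\vec C$''. (1) Let $A$ have free term variables $\vec x,y$ ($\vec x$ nonempty), let $\vec C=(C_i(x_i))_i$ with $C_i$ having only $x_i$ free, and let $D(y)$ have only $y$ free. If $A\in\mathcal T_{\vec C(\vec x),D(y)}$, then $\big(\forall_y(D(y)\to A)\big)\in\mathcal T_{\vec C}$. (2) Let $\vec y$ be the free term variables of $B$, let $\vec D(\vec y)=(D_j(y_j))_j$ with $D_j$ having only $y_j$ free, let $\vec x$ be the free term variables of $A$ that are not free in $B$, and let $R_i:=(x_i\equiv x_i)$ for $i<|\vec x|$. If $B\in\mathcal T_{\vec D(\vec y)}$, then $(A\to B)\in\mathcal T_{\vec D(\vec y),\vec R(\vec x)}$. (3) Let $A$ have free term variables $\vec x,\vec y$ and $B$ have free term variables $\vec x,\vec z$, where $\vec x$ are the common ones. If $A\in\mathcal T_{\vec C_A(\vec x),\vec D_A(\vec y)}$ and $B\in\mathcal T_{\vec C_B(\vec x),\vec D_B(\vec z)}$ (each formula in these lists having exactly the corresponding single variable free), then $(A\wedge B)\in\mathcal T_{\vec C_A\wedge\vec C_B,\,\vec D_A,\,\vec D_B}$, where $\vec C_A\wedge\vec C_B=\big(C_{Ai}(x_i)\wedge C_{Bi}(x_i)\big)_i$.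
   Context: **Types and terms of TCF.** Types are $\rho,\sigma::=\alpha\mid\rho\to\sigma\mid\iota$, with $\alpha$ type variables and $\iota=\langle C_i:\vec\rho_i[\beta/\iota]\to\iota\rangle_{i<k}$ free algebras given by constructors, $\beta$ occurring at most strictly positively in each argument type; e.g. the booleans $\mathbb B$ with constructors $\mathtt f,\mathtt t$. Terms are simply typed: $t,s::=x^\rho\mid\lambda_xt\mid ts\mid C_i\mid D$ (here $C_i$ constructors), where $D$ ranges over program constants introduced by finitely many computation rules $D\vec P_i:=t_i$ with $\vec P_i$ constructor patterns (built from variables and constructors), non-unifiable for different $i$. Computation need not terminate (terms are partial). Terms are identified up to renaming, $\beta$-equality and computation rules. **Formulas and predicates** are defined simultaneously by $$P::=X\mid\{\vec x\mid A\}\mid\mu_X\vec K\mid\nu_X\vec K,\qquad A,B::=P\vec t\mid A\to B\mid A\wedge B\mid A\vee B\mid\forall_xA\mid\exists_xA,$$ with $X$ predicate variables with arities (lists of types), $\vec x$ in $\{\vec x\mid A\}$ exactly the free term variables of $A$, and $\{\vec x\mid A\}\vec y$ identified with $A[\vec x/\vec y]$. $\vec K$ is a finite list of clauses $K_i=\forall_{\vec x_i}(A_{i0}(X)\to\dots\to A_{i,n_i-1}(X)\to X\vec t_i)$, $i<k$, without free term variables, where $X$ occurs at most strictly positively in each premise $A_{i\nu}$ (never free to the left of an implication, including inside the clauses of nested predicates). $\mu_X\vec K$ is an inductive, $\nu_X\vec K$ a coinductive predicate. Put $P\cap Q=\{\vec x\mid P\vec x\wedge Q\vec x\}$, $P\cup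 Q=\{\vec x\mid P\vec x\vee Q\vec x\}$, $P\subseteq Q:=\forall_{\vec x}(P\vec x\to Q\vec x)$. **Derivations.** Minimal natural deduction with the usual introduction and elimination axioms for $\wedge,\vee,\exists$, and the following axioms. For $I=\mu_X\vec K$: $\forall_{\vec x_i}(\vec A_i(I)\to I\vec t_i)$ for $i<k$, and for every predicate $P$ the induction axiom $\big(\forall_{\vec x_i}(\vec A_i(I\cap P)\to P\vec t_i)\big)_{i<k}\to I\subseteq P$. For $J=\nu_X\vec K$, with $\Phi(X)=\{\vec y\mid\bigvee_{i<k}\exists_{\vec x_i}(\vec y\equiv\vec t_i\wedge\bigwedge\vec A_i(X))\}$: $J\subseteq\Phi(J)$, and for every predicate $Q$, $Q\subseteq\Phi(J\cup Q)\to Q\subseteq J$. Leibniz equality is $\equiv\,:=\mu_X(\forall_xXxx)$; $\vec x\equiv\vec y$ is the componentwise conjunction; $\bot:=(\mathtt f\equiv\mathtt t)$; $\neg A:=A\to\bot$. $\vdash A$ means $A$ is derivable. **Strong negation.** To each predicate variable $X$ are assigned new distinct predicate variables $X',X'',\dots$ of the same arity, with $(X^{(n)})'=X^{(n+1)}$ and $X^{(n)}\ne Y^{(m)}$ if $X\neq Y$. Define $(P\vec t)^{\mathbf N}=P^{\mathbf N}\vec t$, $(A\to B)^{\mathbf N}=A\wedge B^{\mathbf N}$, $(A\wedge B)^{\mathbf N}=A^{\mathbf N}\vee B^{\mathbf N}$, $(A\vee B)^{\mathbf N}=A^{\mathbf N}\wedge B^{\mathbf N}$, $(\forall_xA)^{\mathbf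 N}=\exists_xA^{\mathbf N}$, $(\exists_xA)^{\mathbf N}=\forall_xA^{\mathbf N}$, $X^{\mathbf N}=X'$, $\{\vec x\mid A\}^{\mathbf N}=\{\vec x\mid A^{\mathbf N}\}$. For a finite list of clauses $\vec K=\big(\forall_{\vec x_i}(A_{i0}(X)\to\dots\to A_{i,n_i-1}(X)\to X\vec t_i)\big)_{i<k}$ without free term variables, with $X$ at most strictly positive in each premise $A_{i\nu}$, let $E(X')(\vec y):=\bigwedge_{i<k}\forall_{\vec x_i}(\vec y\equiv\vec t_i\to B_i)$, where $B_i:=\bigvee_{\nu<n_i}A_{i\nu}^{\mathbf N}$ if $n_i>0$ and $B_i:=\bot$ if $n_i=0$. Then $(\mu_X\vec K)^{\mathbf N}$ is the greatest fixed point $\nu_{X'}\big(\forall_{\vec y}(X'\vec y\to E(X')(\vec y))\big)$ (i.e. the coinductive predicate with the single clause $\forall_{\vec y}(E(X')(\vec y)\to X'\vec y)$), and $(\nu_X\vec K)^{\mathbf N}$ is the inductive predicate $\mu_{X'}\big(\forall_{\vec y}(E(X')(\vec y)\to X'\vec y)\big)$. **Relative tightness.** Let $F$ be a formula with free term variables exactly $\vec x=x_0,\dots,x_{n-1}$, $n>0$, and for $i<n$ let $C_i$ be a formula whose only free term variable is $x_i$. $F$ is tight relative to $\vec C$, written $F\in\mathcal T_{\vec C}$, if $\vdash\forall_{\vec x}\big(C_0\to\dots\to C_{n-1}\to\neg(F^{\mathbf N})\to F\big)$. *)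

(* Defs.v *)
From HB Require Import structures.
From mathcomp Require Import all_boot.
From Stdlib Require List.

Set Implicit Arguments.
Unset Strict Implicit.
Unset Printing Implicit Defensive.

(* The syntax is locally nameless: free variables are named, bound variables
   are de Bruijn indices, so that "up to renaming" is syntactic equality.
   Raw syntax is carved out by boolean well-formedness tests.  A block of
   simultaneously bound variables x_0, ..., x_(n-1) binds the indices
   n-1, ..., 0 (the last variable is the innermost one, as if they had been
   bound one after the other). *)

(* [Alg css] is the free algebra with one constructor for each member of
   [css], which lists the argument types of that constructor; it binds one
   type index, standing for the algebra itself. *)
Inductive ty : Type :=
| TVar of nat
| TBnd of nat
| Arr of ty & ty
| Alg of seq (seq ty).

Fixpoint ty_eqb (r s : ty) {struct r} : bool :=
  match r, s with
  | TVar m, TVar n => m == n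
  | TBnd m, TBnd n => m == n
  | Arr r1 r2, Arr s1 s2 => ty_eqb r1 s1 && ty_eqb r2 s2
  | Alg c, Alg d => all2 (all2 ty_eqb) c d
  | _, _ => false
  end.

Lemma all2_eqP (T : Type) (e : T -> T -> bool) (s : seq T) :
  List.Forall (fun x => forall y, e x y <-> x = y) s ->
  forall t, all2 e s t <-> s = t.
Proof.
elim=> [|x {}s eP _ IHs] [|y t] //=; split=> [/andP[/eP-> /IHs->] //|[<- <-]].
by apply/andP; split; [apply/eP | apply/IHs].
Qed.

Lemma ty_eqP : Equality.axiom ty_eqb.
Proof.
suff H r s : ty_eqb r s <-> r = s by move=> r s; apply: (iffP idP) => /H.
move: r s; fix IH 1; case=> [m|m|r1 r2|c] [n|n|s1 s2|d] //=.
- by split=> [/eqP->|[->]].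
- by split=> [/eqP->|[->]].
- split=> [/andP[/IH-> /IH->] //|[<- <-]].
  by apply/andP; split; apply/IH.
- have H : List.Forall (fun cs => forall ds, all2 ty_eqb cs ds <-> cs = ds) c.
    elim: c => [|cs c IHc]; constructor=> //; apply: all2_eqP.
    elim: cs => [|r cs IHcs]; constructor=> //; exact: IH.
  have [Hcd Hdc] := all2_eqP H d.
  by split=> [/Hcd->|[/Hdc]].
Qed.

HB.instance Definition _ := hasDecEq.Build ty ty_eqP.

(* [r] is locally closed in every use, so no shifting is needed. *)
Fixpoint ty_open (k : nat) (r : ty) (s : ty) : ty :=
  match s with
  | TVar a => TVar a
  | TBnd j => if j == k then r else TBnd j
  | Arr s1 s2 => Arr (ty_open k r s1) (ty_open k r s2)
  | Alg css => Alg [seq [seq ty_open k.+1 r s' | s' <- cs] | cs <- css]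
  end.

(* [d] counts the enclosing algebras.  Their indices may not be used to the
   left of an arrow: this is strict positivity. *)
Fixpoint wf_ty (d : nat) (r : ty) : bool :=
  match r with
  | TVar _ => true
  | TBnd j => j < d
  | Arr r1 r2 => wf_ty 0 r1 && wf_ty d r2
  | Alg css => all (all (wf_ty d.+1)) css
  end.

Definition arrs (rs : seq ty) (s : ty) : ty := foldr Arr s rs.

Definition con_ty (css : seq (seq ty)) (i : nat) : ty :=
  arrs [seq ty_open 0 (Alg css) r | r <- nth [::] css i] (Alg css).

Definition bool_css : seq (seq ty) := [:: [::]; [::]].
Definition tbool : ty := Alg bool_css.

Definition var : Type := (nat * ty)%type.

(* [Con css i] is the i-th constructor of [Alg css]; [K] is the type of names
   of program constants. *)
Inductive tm (K : Type) : Type :=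
| FVar of var
| BVar of nat
| Lam of ty & tm K
| App of tm K & tm K
| Con of seq (seq ty) & nat
| Cst of K.

Arguments FVar {K}.
Arguments BVar {K}.
Arguments Con {K}.
Arguments Cst {K}.

Definition apps {K : Type} (t : tm K) (ts : seq (tm K)) : tm K :=
  foldl (@App K) t ts.

Fixpoint tfv {K : Type} (t : tm K) : seq var :=
  match t with
  | FVar x => [:: x]
  | Lam _ t1 => tfv t1
  | App t1 t2 => tfv t1 ++ tfv t2
  | _ => [::]
  end.

Definition tsfv {K : Type} (ts : seq (tm K)) : seq var := flatten (map tfv ts).

Fixpoint tocc {K : Type} (k : nat) (t : tm K) : bool :=
  match t with
  | BVar j => j == k
  | Lam _ t1 => tocc k.+1 t1
  | App t1 t2 => tocc k t1 || tocc k t2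
  | _ => false
  end.

Fixpoint tshift {K : Type} (c d : nat) (t : tm K) : tm K :=
  match t with
  | BVar j => if j < c then BVar j else BVar (j + d)
  | Lam r t1 => Lam r (tshift c.+1 d t1)
  | App t1 t2 => App (tshift c d t1) (tshift c d t2)
  | _ => t
  end.

(* Instantiates the indices k, k+1, ... by the members of [us]. *)
Fixpoint tinst {K : Type} (k : nat) (us : seq (tm K)) (t : tm K) : tm K :=
  match t with
  | BVar j =>
      if j < k then BVar j
      else if j - k < size us then tshift 0 k (nth (BVar j) us (j - k))
      else BVar (j - size us)
  | Lam r t1 => Lam r (tinst k.+1 us t1)
  | App t1 t2 => App (tinst k us t1) (tinst k us t2)
  | _ => t
  end.

Fixpoint tsubst {K : Type} (th : var -> tm K) (t : tm K) : tm K :=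
  match t with
  | FVar x => th x
  | Lam r t1 => Lam r (tsubst (fun x => tshift 0 1 (th x)) t1)
  | App t1 t2 => App (tsubst th t1) (tsubst th t2)
  | _ => t
  end.

Fixpoint tclose {K : Type} (k : nat) (x : var) (t : tm K) : tm K :=
  match t with
  | FVar y => if y == x then BVar k else FVar y
  | Lam r t1 => Lam r (tclose k.+1 x t1)
  | App t1 t2 => App (tclose k x t1) (tclose k x t2)
  | _ => t
  end.

(* Program constants: [D : arrs (cst_dom D) (cst_cod D)], and a pair [(Ps, t)] in
   [cst_rules D] is the computation rule [D Ps := t]. *)
Record signature : Type := Signature {
  cst :> Type;
  cst_dom : cst -> seq ty;
  cst_cod : cst -> ty;
  cst_rules : cst -> seq (seq (tm cst) * tm cst) }.

(* The type of a term in a context giving the types of the bound variables,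
   [None] if the term is ill-typed. *)
Fixpoint tyof (S : signature) (De : seq ty) (t : tm S) : option ty :=
  match t with
  | FVar x => if wf_ty 0 x.2 then Some x.2 else None
  | BVar j => onth De j
  | Lam r t1 =>
      if wf_ty 0 r then omap (Arr r) (tyof (r :: De) t1) else None
  | App t1 t2 =>
      match tyof De t1, tyof De t2 with
      | Some (Arr r s), Some r' => if r == r' then Some s else None
      | _, _ => None
      end
  | Con css i =>
      if wf_ty 0 (Alg css) && (i < size css) then Some (con_ty css i) else None
  | Cst D => Some (arrs (cst_dom D) (cst_cod D))
  end.

Definition typed_as (S : signature) (De : seq ty) (ts : seq (tm S))
    (rs : seq ty) : bool :=
  map (tyof De) ts == map Some rs.

Definition is_fvar {K : Type} (t : tm K) : bool :=
  if t is FVar _ then true else false.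

Fixpoint con_pattern {K : Type} (t : tm K) : bool :=
  match t with
  | Con _ _ => true
  | App t1 t2 => con_pattern t1 && (is_fvar t2 || con_pattern t2)
  | _ => false
  end.

Definition is_pattern {K : Type} (t : tm K) : bool := is_fvar t || con_pattern t.

Definition wf_rule (S : signature) (D : S) (rl : seq (tm S) * tm S) : Prop :=
  [/\ all is_pattern rl.1, typed_as [::] rl.1 (cst_dom D),
      tyof [::] rl.2 = Some (cst_cod D) & {subset tfv rl.2 <= tsfv rl.1}].

(* The two substitutions amount to renaming the rules apart. *)
Definition unifiable {K : Type} (Ps Qs : seq (tm K)) : Prop :=
  exists th1 th2 : var -> tm K, map (tsubst th1) Ps = map (tsubst th2) Qs.

Definition wf_signature (S : signature) : Prop :=
  forall D : S,
    [/\ all (wf_ty 0) (cst_dom D), wf_ty 0 (cst_cod D),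
        forall rl, List.In rl (cst_rules D) -> wf_rule D rl
      & forall rl0 i j, i < size (cst_rules D) -> j < size (cst_rules D) -> i != j ->
          ~ unifiable (nth rl0 (cst_rules D) i).1 (nth rl0 (cst_rules D) j).1].

Inductive tstep (S : signature) : tm S -> tm S -> Prop :=
| ts_beta r t s : tstep (App (Lam r t) s) (tinst 0 [:: s] t)
| ts_rule (D : S) rl (th : var -> tm S) : List.In rl (cst_rules D) ->
    tstep (apps (Cst D) (map (tsubst th) rl.1)) (tsubst th rl.2)
| ts_lam r t t' : tstep t t' -> tstep (Lam r t) (Lam r t')
| ts_appl t t' s : tstep t t' -> tstep (App t s) (App t' s)
| ts_appr t s s' : tstep s s' -> tstep (App t s) (App t s').

(* A predicate variable X^(n) with its arity. *)
Record pvar : Type := PVar { pv_name : nat; pv_primes : nat; pv_ar : seq ty }.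

Definition pv_prime (X : pvar) : pvar :=
  PVar (pv_name X) (pv_primes X).+1 (pv_ar X).

(* [Compr rs A] is {xs | A} with xs of types rs.  [Mu rs Ks] and [Nu rs Ks]
   bind one predicate index X of arity rs in the clauses [Ks].
   [Clause rs As ts] is forall xs, As -> X ts with xs of types rs. *)
Inductive form (K : Type) : Type :=
| Atom of fpred K & seq (tm K)
| Imp of form K & form K
| And of form K & form K
| Or of form K & form K
| All of ty & form K
| Ex of ty & form K
with fpred (K : Type) : Type :=
| PFree of pvar
| PBnd of nat
| Compr of seq ty & form K
| Mu of seq ty & seq (clause K)
| Nu of seq ty & seq (clause K)
with clause (K : Type) : Type :=
| Clause of seq ty & seq (form K) & seq (tm K).

Arguments PFree {K}.
Arguments PBnd {K}.

(* Predicates have no free term variables (see [wf_pred]), hence the operations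
   on term variables below do not descend into them. *)
Fixpoint fv {K : Type} (A : form K) : seq var :=
  match A with
  | Atom _ ts => tsfv ts
  | Imp B C | And B C | Or B C => fv B ++ fv C
  | All _ B | Ex _ B => fv B
  end.

Fixpoint focc {K : Type} (k : nat) (A : form K) : bool :=
  match A with
  | Atom _ ts => has (tocc k) ts
  | Imp B C | And B C | Or B C => focc k B || focc k C
  | All _ B | Ex _ B => focc k.+1 B
  end.

Fixpoint finst {K : Type} (k : nat) (us : seq (tm K)) (A : form K) : form K :=
  match A with
  | Atom P ts => Atom P (map (tinst k us) ts)
  | Imp B C => Imp (finst k us B) (finst k us C)
  | And B C => And (finst k us B) (finst k us C)
  | Or B C => Or (finst k us B) (finst k us C)
  | All r B => All r (finst k.+1 us B)
  | Ex r B => Ex r (finst k.+1 us B)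
  end.

Fixpoint fclose {K : Type} (k : nat) (x : var) (A : form K) : form K :=
  match A with
  | Atom P ts => Atom P (map (tclose k x) ts)
  | Imp B C => Imp (fclose k x B) (fclose k x C)
  | And B C => And (fclose k x B) (fclose k x C)
  | Or B C => Or (fclose k x B) (fclose k x C)
  | All r B => All r (fclose k.+1 x B)
  | Ex r B => Ex r (fclose k.+1 x B)
  end.

Definition AllV {K : Type} (x : var) (A : form K) : form K :=
  All x.2 (fclose 0 x A).
Definition ExV {K : Type} (x : var) (A : form K) : form K :=
  Ex x.2 (fclose 0 x A).

(* Substitution of the predicate [P], which has no unbound index, for a bound
   predicate variable. *)
Fixpoint fpopen {K : Type} (k : nat) (P : fpred K) (A : form K) : form K :=
  match A with
  | Atom Q ts => Atom (ppopen k P Q) ts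
  | Imp B C => Imp (fpopen k P B) (fpopen k P C)
  | And B C => And (fpopen k P B) (fpopen k P C)
  | Or B C => Or (fpopen k P B) (fpopen k P C)
  | All r B => All r (fpopen k P B)
  | Ex r B => Ex r (fpopen k P B)
  end
with ppopen {K : Type} (k : nat) (P : fpred K) (Q : fpred K) : fpred K :=
  match Q with
  | PFree X => PFree X
  | PBnd j => if j == k then P else PBnd j
  | Compr rs A => Compr rs (fpopen k P A)
  | Mu rs Ks => Mu rs (map (cpopen k.+1 P) Ks)
  | Nu rs Ks => Nu rs (map (cpopen k.+1 P) Ks)
  end
with cpopen {K : Type} (k : nat) (P : fpred K) (c : clause K) : clause K :=
  match c with
  | Clause rs As ts => Clause rs (map (fpopen k P) As) ts
  end.

Definition arity {K : Type} (Xi : seq (seq ty)) (P : fpred K) : seq ty :=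
  match P with
  | PFree X => pv_ar X
  | PBnd j => nth [::] Xi j
  | Compr rs _ | Mu rs _ | Nu rs _ => rs
  end.

(* [Xi] lists the arities of the bound predicate variables, [De] the types of
   the bound term variables.  Clearing [Xi] to the left of an implication
   enforces strict positivity, also inside nested predicates. *)
Fixpoint wf_form (S : signature) (Xi : seq (seq ty)) (De : seq ty)
    (A : form S) : bool :=
  match A with
  | Atom P ts => wf_pred Xi P && typed_as De ts (arity Xi P)
  | Imp B C => wf_form [::] De B && wf_form Xi De C
  | And B C | Or B C => wf_form Xi De B && wf_form Xi De C
  | All r B | Ex r B => wf_ty 0 r && wf_form Xi (r :: De) B
  end
with wf_pred (S : signature) (Xi : seq (seq ty)) (P : fpred S) : bool :=
  match P with
  | PFree X => all (wf_ty 0) (pv_ar X)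
  | PBnd j => j < size Xi
  | Compr rs A =>
      [&& all (wf_ty 0) rs, wf_form Xi (rev rs) A, nilp (fv A)
        & all (fun j => focc j A) (iota 0 (size rs))]
  | Mu rs Ks | Nu rs Ks =>
      all (wf_ty 0) rs && all (wf_clause (rs :: Xi) rs) Ks
  end
with wf_clause (S : signature) (Xi : seq (seq ty)) (ar : seq ty)
    (c : clause S) : bool :=
  match c with
  | Clause rs As ts =>
      [&& all (wf_ty 0) rs,
          all (fun A => wf_form Xi (rev rs) A && nilp (fv A)) As,
          typed_as (rev rs) ts ar & nilp (tsfv ts)]
  end.

Definition wf (S : signature) (A : form S) : bool := wf_form [::] [::] A.

Definition Imps {K : Type} (As : seq (form K)) (B : form K) : form K :=
  foldr (@Imp K) B As.
Definition Alls {K : Type} (rs : seq ty) (A : form K) : form K :=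
  foldr (@All K) A rs.
Definition Exs {K : Type} (rs : seq ty) (A : form K) : form K :=
  foldr (@Ex K) A rs.

(* The last [n] bound variables, in order of binding, below [m] further ones. *)
Definition bvars {K : Type} (m n : nat) : seq (tm K) :=
  [seq BVar (m + i) | i <- rev (iota 0 n)].

Definition Leibp {K : Type} (r : ty) : fpred K :=
  Mu [:: r; r] [:: Clause [:: r] [::] [:: BVar 0; BVar 0]].
Definition Leib {K : Type} (r : ty) (t s : tm K) : form K :=
  Atom (Leibp r) [:: t; s].
Definition Bot {K : Type} : form K :=
  Leib tbool (Con bool_css 0) (Con bool_css 1).
Definition Neg {K : Type} (A : form K) : form K := Imp A Bot.
Definition Top {K : Type} : form K := Imp Bot Bot.

Fixpoint Conj {K : Type} (As : seq (form K)) : form K :=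
  match As with
  | [::] => Top
  | [:: A] => A
  | A :: As' => And A (Conj As')
  end.
Fixpoint Disj {K : Type} (As : seq (form K)) : form K :=
  match As with
  | [::] => Bot
  | [:: A] => A
  | A :: As' => Or A (Disj As')
  end.

Definition Leibs {K : Type} (rs : seq ty) (ts ss : seq (tm K)) : form K :=
  Conj [seq Leib p.1 p.2.1 p.2.2 | p <- zip rs (zip ts ss)].

(* In [pcap], [pcup] and [psub], [rs] is the arity of [P] and [Q]. *)
Definition pcap {K : Type} (rs : seq ty) (P Q : fpred K) : fpred K :=
  Compr rs (And (Atom P (bvars 0 (size rs))) (Atom Q (bvars 0 (size rs)))).
Definition pcup {K : Type} (rs : seq ty) (P Q : fpred K) : fpred K :=
  Compr rs (Or (Atom P (bvars 0 (size rs))) (Atom Q (bvars 0 (size rs)))).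
Definition psub {K : Type} (rs : seq ty) (P Q : fpred K) : form K :=
  Alls rs (Imp (Atom P (bvars 0 (size rs))) (Atom Q (bvars 0 (size rs)))).

(* For the clause [c], forall xs (As(P) -> Q ts). *)
Definition clause_form {K : Type} (P Q : fpred K) (c : clause K) : form K :=
  match c with
  | Clause rs As ts => Alls rs (Imps (map (fpopen 0 P) As) (Atom Q ts))
  end.

(* [Phi ar Ks P] is the formula Phi(P)(ys), where ys are the innermost bound
   variables, of types [ar]. *)
Definition Phi {K : Type} (ar : seq ty) (Ks : seq (clause K)) (P : fpred K) :
    form K :=
  Disj [seq match c with
            | Clause rs As ts =>
                Exs rs (And (Leibs ar (bvars (size rs) (size ar)) ts)
                            (Conj (map (fpopen 0 P) As)))
            end | c <- Ks].

(* Identification of terms, and of {xs | A} ts with A[xs/ts], in formulas. *)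
Inductive fstep (S : signature) : form S -> form S -> Prop :=
| fs_arg P ts1 t t' ts2 : tstep t t' ->
    fstep (Atom P (ts1 ++ t :: ts2)) (Atom P (ts1 ++ t' :: ts2))
| fs_pred P P' ts : pstep P P' -> fstep (Atom P ts) (Atom P' ts)
| fs_compr rs A ts : size ts = size rs ->
    fstep (Atom (Compr rs A) ts) (finst 0 (rev ts) A)
| fs_impl A A' B : fstep A A' -> fstep (Imp A B) (Imp A' B)
| fs_impr A B B' : fstep B B' -> fstep (Imp A B) (Imp A B')
| fs_andl A A' B : fstep A A' -> fstep (And A B) (And A' B)
| fs_andr A B B' : fstep B B' -> fstep (And A B) (And A B')
| fs_orl A A' B : fstep A A' -> fstep (Or A B) (Or A' B)
| fs_orr A B B' : fstep B B' -> fstep (Or A B) (Or A B')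
| fs_all r A A' : fstep A A' -> fstep (All r A) (All r A')
| fs_ex r A A' : fstep A A' -> fstep (Ex r A) (Ex r A')
with pstep (S : signature) : fpred S -> fpred S -> Prop :=
| ps_compr rs A A' : fstep A A' -> pstep (Compr rs A) (Compr rs A')
| ps_mu rs Ks1 c c' Ks2 : cstep c c' ->
    pstep (Mu rs (Ks1 ++ c :: Ks2)) (Mu rs (Ks1 ++ c' :: Ks2))
| ps_nu rs Ks1 c c' Ks2 : cstep c c' ->
    pstep (Nu rs (Ks1 ++ c :: Ks2)) (Nu rs (Ks1 ++ c' :: Ks2))
with cstep (S : signature) : clause S -> clause S -> Prop :=
| cs_prem rs As1 A A' As2 ts : fstep A A' ->
    cstep (Clause rs (As1 ++ A :: As2) ts) (Clause rs (As1 ++ A' :: As2) ts)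
| cs_arg rs As ts1 t t' ts2 : tstep t t' ->
    cstep (Clause rs As (ts1 ++ t :: ts2)) (Clause rs As (ts1 ++ t' :: ts2)).

(* Only the well-formed instances are axioms, see [d_axiom]; this forces P in
   [ax_muE] and Q in [ax_nuI] to have arity [rs]. *)
Inductive is_axiom (S : signature) : form S -> Prop :=
| ax_andI A B : is_axiom (Imp A (Imp B (And A B)))
| ax_andEl A B : is_axiom (Imp (And A B) A)
| ax_andEr A B : is_axiom (Imp (And A B) B)
| ax_orIl A B : is_axiom (Imp A (Or A B))
| ax_orIr A B : is_axiom (Imp B (Or A B))
| ax_orE A B C : is_axiom (Imp (Or A B) (Imp (Imp A C) (Imp (Imp B C) C)))
| ax_exI x A : is_axiom (AllV x (Imp A (ExV x A)))
| ax_exE x A B : x \notin fv B ->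
    is_axiom (Imp (ExV x A) (Imp (AllV x (Imp A B)) B))
| ax_muI rs Ks c : List.In c Ks ->
    is_axiom (clause_form (Mu rs Ks) (Mu rs Ks) c)
| ax_muE rs Ks P :
    is_axiom (Imps (map (clause_form (pcap rs (Mu rs Ks) P) P) Ks)
                   (psub rs (Mu rs Ks) P))
| ax_nuE rs Ks :
    is_axiom (Alls rs (Imp (Atom (Nu rs Ks) (bvars 0 (size rs)))
                           (Phi rs Ks (Nu rs Ks))))
| ax_nuI rs Ks Q :
    is_axiom (Imp (Alls rs (Imp (Atom Q (bvars 0 (size rs)))
                                (Phi rs Ks (pcup rs (Nu rs Ks) Q))))
                  (psub rs Q (Nu rs Ks))).

Inductive deriv (S : signature) : seq (form S) -> form S -> Prop :=
| d_hyp Ga A : List.In A Ga -> wf A -> deriv Ga A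
| d_axiom Ga A : is_axiom A -> wf A -> deriv Ga A
| d_impI Ga A B : wf A -> deriv (A :: Ga) B -> deriv Ga (Imp A B)
| d_impE Ga A B : deriv Ga (Imp A B) -> deriv Ga A -> deriv Ga B
| d_allI Ga x A : wf_ty 0 x.2 ->
    (forall B, List.In B Ga -> x \notin fv B) ->
    deriv Ga A -> deriv Ga (AllV x A)
| d_allE Ga r A t : deriv Ga (All r A) -> tyof [::] t = Some r ->
    deriv Ga (finst 0 [:: t] A)
| d_conv Ga A B : deriv Ga A -> fstep A B \/ fstep B A -> wf B -> deriv Ga B.

(* In well-formed input a bound predicate variable X never occurs to the left
   of an implication, so every occurrence of X in a clause premise A becomes X'
   in A^N; keeping its index therefore makes the dual binder bind X'. *)
Fixpoint sneg {K : Type} (A : form K) : form K :=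
  match A with
  | Atom P ts => Atom (psneg P) ts
  | Imp B C => And B (sneg C)
  | And B C => Or (sneg B) (sneg C)
  | Or B C => And (sneg B) (sneg C)
  | All r B => Ex r (sneg B)
  | Ex r B => All r (sneg B)
  end
with psneg {K : Type} (P : fpred K) : fpred K :=
  match P with
  | PFree X => PFree (pv_prime X)
  | PBnd j => PBnd j
  | Compr rs A => Compr rs (sneg A)
  | Mu rs Ks =>
      Nu rs [:: Clause rs [:: Conj (map (csneg rs) Ks)] (bvars 0 (size rs))]
  | Nu rs Ks =>
      Mu rs [:: Clause rs [:: Conj (map (csneg rs) Ks)] (bvars 0 (size rs))]
  end
(* The conjunct of E(X')(ys) given by a clause; ys, of types [ar], are the
   innermost bound variables. *)
with csneg {K : Type} (ar : seq ty) (c : clause K) : form K :=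
  match c with
  | Clause rs As ts =>
      Alls rs (Imp (Leibs ar (bvars (size rs) (size ar)) ts)
                   (Disj (map sneg As)))
  end.

Definition only_free (S : signature) (x : var) (C : form S) : Prop :=
  wf C /\ fv C =i [:: x].

(* [tight xs Cs F]: F, with free term variables exactly xs, is tight relative
   to Cs, the i-th member of Cs having exactly the i-th member of xs free. *)
Definition tight (S : signature) (xs : seq var) (Cs : seq (form S))
    (F : form S) : Prop :=
  [/\ wf F, uniq xs /\ 0 < size xs, fv F =i xs,
      List.Forall2 (@only_free S) xs Cs
    & deriv [::] (foldr AllV (Imps Cs (Imp (Neg (sneg F)) F)) xs)].

(* Main.v *)
Require Import Defs.
From HB Require Import structures.
From mathcomp Require Import all_boot.
From Stdlib Require List.

Set Implicit Arguments.
Unset Strict Implicit.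
Unset Printing Implicit Defensive.

(** Each part is a short argument in minimal logic, resting on the dual shape of
    strong negation: in each case the strong negation Z of the compound formula
    follows from the strong negation of an immediate subformula F together with
    the hypotheses at hand.
    - For F = A in [forall y (D -> A)], Z is [exists y (D /\ A^N)]; from D and
      A^N one gets Z with y itself as the witness.
    - For F = B in [A -> B], Z is [A /\ B^N]; from A and B^N one gets Z.
    - For F = A or F = B in [A /\ B], Z is [A^N \/ B^N].
    So the hypothesis that Z is refutable refutes F^N, and the tightness of F
    yields F.  This common step is [deriv_by_tightness].

    Working with actual derivations adds two obligations.  Since only
    well-formed formulas may be used as hypotheses and axioms, strong negation
    has to preserve well-formedness ([wf_form_sneg]).  This is proved by
    induction through nested predicates, and the dual of an inductive
    predicate moves the premises of its clauses below further quantifiers, so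
    it relies on weakening of contexts of bound variables ([wf_form_weak]).
    The other obligation comes from eigenvariables: a derivation cannot be
    given an additional hypothesis without renaming, because that hypothesis
    may contain a variable that the derivation generalises.  Therefore the
    given tightness statement is cut in as a hypothesis at the bottom of the
    list from the start ([tight_intro]); in part (1) it is universally closed
    in y, so that y can still be generalised afterwards. *)

(** * Induction on formulas, predicates and clauses *)

(** The generated induction principles give no hypothesis for the members of
    the lists of clauses and premises. *)
Section NestedInduction.
Variables (K : Type) (P : form K -> Prop) (Q : fpred K -> Prop)
  (R : clause K -> Prop).
Hypotheses
  (hAtom : forall p ts, Q p -> P (Atom p ts))
  (hImp : forall A B, P A -> P B -> P (Imp A B))
  (hAnd : forall A B, P A -> P B -> P (And A B))
  (hOr : forall A B, P A -> P B -> P (Or A B))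
  (hAll : forall r A, P A -> P (All r A))
  (hEx : forall r A, P A -> P (Ex r A))
  (hFree : forall X, Q (PFree X))
  (hBnd : forall j, Q (PBnd j))
  (hCompr : forall rs A, P A -> Q (Compr rs A))
  (hMu : forall rs Ks, List.Forall R Ks -> Q (Mu rs Ks))
  (hNu : forall rs Ks, List.Forall R Ks -> Q (Nu rs Ks))
  (hClause : forall rs As ts, List.Forall P As -> R (Clause rs As ts)).

Fixpoint form_nested_ind (A : form K) : P A :=
  match A with
  | Atom p ts => hAtom ts (pred_nested_ind p)
  | Imp B C => hImp (form_nested_ind B) (form_nested_ind C)
  | And B C => hAnd (form_nested_ind B) (form_nested_ind C)
  | Or B C => hOr (form_nested_ind B) (form_nested_ind C)
  | All r B => hAll r (form_nested_ind B)
  | Ex r B => hEx r (form_nested_ind B)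
  end
with pred_nested_ind (p : fpred K) : Q p :=
  let clauses_ind :=
    fix clauses_ind (Ks : seq (clause K)) : List.Forall R Ks :=
    match Ks with
    | [::] => List.Forall_nil _
    | c :: Ks' => List.Forall_cons _ (clause_nested_ind c) (clauses_ind Ks')
    end in
  match p with
  | PFree X => hFree X
  | PBnd j => hBnd j
  | Compr rs A => hCompr rs (form_nested_ind A)
  | Mu rs Ks => hMu rs (clauses_ind Ks)
  | Nu rs Ks => hNu rs (clauses_ind Ks)
  end
with clause_nested_ind (c : clause K) : R c :=
  match c with
  | Clause rs As ts => hClause rs ts
      ((fix forms_ind (As : seq (form K)) : List.Forall P As :=
          match As with
          | [::] => List.Forall_nil _
          | A :: As' => List.Forall_cons _ (form_nested_ind A) (forms_ind As')
          end) As)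
  end.
End NestedInduction.

Section RelativeTightness.
Variable S : signature.
Implicit Types (t : tm S) (ts : seq (tm S)) (De rs : seq ty) (x : var).
Implicit Types (A B : form S) (Xi : seq (seq ty)).

(** * Typed terms *)

Lemma tyof_weak t De De' r : tyof De t = Some r -> tyof (De ++ De') t = Some r.
Proof.
elim: t De r => [x|j|s t IH|t IHt u IHu|css i|D] De r //=.
- move=> e; rewrite onth_cat; case: ltnP => // le.
  by rewrite onth_default in e.
- case: ifP => // _; case e: (tyof _ t) => [s'|] //= [<-].
  by rewrite -cat_cons (IH _ _ e).
- case et: (tyof De t) => [s|] //; case eu: (tyof De u) => [s'|];
    by rewrite ?(IHt _ _ et) ?(IHu _ _ eu) //; case: s et.
Qed.

Lemma tyof_tclose t De x r : tyof De t = Some r ->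
  tyof (rcons De x.2) (tclose (size De) x t) = Some r.
Proof.
elim: t De r => [y|j|s t IH|t IHt u IHu|css i|D] De r //=.
- case: (eqVneq y x) => [->|_] //= .
  by case: ifP => // _ [<-]; rewrite -cats1 onth_cat ltnn subnn.
- by move=> e; rewrite -cats1; apply: (@tyof_weak (BVar j)).
- case: ifP => // _; case e: (tyof _ t) => [s'|] //= [<-].
  by rewrite -rcons_cons (IH (s :: De) _ e).
- case et: (tyof De t) => [s|] //; case eu: (tyof De u) => [s'|];
    by rewrite ?(IHt _ _ et) ?(IHu _ _ eu) //; case: s et.
Qed.

(** A typed term has no index beyond its context, so the index created by
    [tclose] is the only one that the instantiation affects. *)
Lemma tinst_tclose t De x r : tyof De t = Some r ->
  tinst (size De) [:: FVar x] (tclose (size De) x t) = t.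
Proof.
elim: t De r => [y|j|s t IH|t IHt u IHu|css i|D] De r //=.
- by case: (eqVneq y x) => [->|_] //= _; rewrite ltnn subnn.
- by move=> e; rewrite -onthTE e.
- case: ifP => // _; case e: (tyof _ t) => [s'|] //= _.
  by congr Lam; apply: (IH (s :: De) _ e).
- case et: (tyof De t) => [s|] //; case eu: (tyof De u) => [s'|];
  last by case: s {et}.
  by rewrite (IHt _ _ et) (IHu _ _ eu).
Qed.

Lemma tyof_wf_fvar t De x r : tyof De t = Some r -> x \in tfv t -> wf_ty 0 x.2.
Proof.
elim: t De r => [y|j|s t IH|t IHt u IHu|css i|D] De r //=.
- by case: ifP => // h _; rewrite inE => /eqP->.
- by case: ifP => // _; case e: (tyof _ t) => [s'|] //= _; apply: IH e.
- case et: (tyof De t) => [s|] //; case eu: (tyof De u) => [s'|];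
  last by case: s {et}.
  by move=> _; rewrite mem_cat => /orP[]; [apply: IHt et | apply: IHu eu].
Qed.

Lemma tfv_tclose k x t : tfv (tclose k x t) = [seq y <- tfv t | y != x].
Proof.
elim: t k => //= [y|t IHt u IHu] k; first by case: eqVneq.
by rewrite IHt IHu filter_cat.
Qed.

Lemma typed_as_cons De t ts r rs :
  typed_as De (t :: ts) (r :: rs) = (tyof De t == Some r) && typed_as De ts rs.
Proof. by rewrite /typed_as /= eqseq_cons. Qed.

Lemma typed_as_map De De' (f : tm S -> tm S) ts rs :
  (forall t r, tyof De t = Some r -> tyof De' (f t) = Some r) ->
  typed_as De ts rs -> typed_as De' (map f ts) rs.
Proof.
move=> hf; elim: ts rs => [|t ts IH] [|r rs] //=.
rewrite !typed_as_cons => /andP[/eqP/hf/eqP-> /IH] //.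
Qed.

Lemma typed_as_weak De De' ts rs :
  typed_as De ts rs -> typed_as (De ++ De') ts rs.
Proof.
by rewrite -{2}(map_id ts); apply: typed_as_map => t r; apply: tyof_weak.
Qed.

Lemma typed_as_tinst_tclose De ts rs x : typed_as De ts rs ->
  map (tinst (size De) [:: FVar x]) (map (tclose (size De) x) ts) = ts.
Proof.
elim: ts rs => [|t ts IH] [|r rs] //=.
by rewrite typed_as_cons => /andP[/eqP/tinst_tclose-> /IH->].
Qed.

Lemma typed_as_wf_fvar De ts rs x :
  typed_as De ts rs -> x \in tsfv ts -> wf_ty 0 x.2.
Proof.
elim: ts rs => [|t ts IH] [|r rs] //; rewrite typed_as_cons /tsfv /=.
move=> /andP[/eqP et /IH hts]; rewrite mem_cat => /orP[|/hts //].
exact: tyof_wf_fvar et.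
Qed.

(** A context lists the innermost binder first, [bvars] the outermost one,
    hence the reversal; the binders of [De] are the ones to skip. *)
Lemma typed_as_bvars De rs :
  typed_as (De ++ rev rs) (@bvars S (size De) (size rs)) rs.
Proof.
rewrite /typed_as /bvars -map_comp map_rev; apply/eqP.
rewrite -[in RHS](revK rs) [in RHS]map_rev; congr rev.
apply: (@eq_from_nth _ None); first by rewrite !size_map size_iota size_rev.
rewrite size_map size_iota => i hi.
rewrite (nth_map 0) ?size_iota // nth_iota //= add0n.
by rewrite -onthE onth_cat ltnNge leq_addr addKn.
Qed.

Lemma tsfv_bvars m n : tsfv (@bvars S m n) = [::].
Proof. by rewrite /bvars /tsfv -map_comp; elim: (rev _). Qed.

(** * Well-formed formulas *)

(** The context [Xi'] is quantified anew in the induction because the premise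
    of an implication is checked in the empty one, which must not grow. *)
Lemma wf_form_weak A Xi Xi' De De' :
  wf_form Xi De A -> wf_form (Xi ++ Xi') (De ++ De') A.
Proof.
move: A Xi Xi' De De'; pose P A := forall Xi Xi' De De',
  @wf_form S Xi De A -> wf_form (Xi ++ Xi') (De ++ De') A.
pose Q p := forall Xi Xi', @wf_pred S Xi p ->
  wf_pred (Xi ++ Xi') p && (arity (Xi ++ Xi') p == arity Xi p).
pose R c := forall Xi Xi' ar,
  @wf_clause S Xi ar c -> wf_clause (Xi ++ Xi') ar c.
have hK Ks : List.Forall R Ks -> forall Xi Xi' ar,
    all (wf_clause Xi ar) Ks -> all (wf_clause (Xi ++ Xi') ar) Ks.
  by elim=> {Ks} //= c Ks hc _ IH Xi Xi' ar /andP[/hc-> /IH->].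
apply: (@form_nested_ind S P Q R); rewrite {}/P {}/Q.
- move=> p ts IH Xi Xi' De De' /= /andP[/(IH _ Xi')/andP[-> /eqP->] h].
  exact: typed_as_weak.
- move=> A B IHA IHB Xi Xi' De De' /= /andP[hA hB]; rewrite IHB // andbT.
  exact: (IHA [::] [::]).
- by move=> A B IHA IHB Xi Xi' De De' /= /andP[/IHA-> /IHB->].
- by move=> A B IHA IHB Xi Xi' De De' /= /andP[/IHA-> /IHB->].
- by move=> r A IH Xi Xi' De De' /= /andP[-> /IH->].
- by move=> r A IH Xi Xi' De De' /= /andP[-> /IH->].
- by move=> X Xi Xi' /= ->; rewrite eqxx.
- by move=> j Xi Xi' /= hj; rewrite size_cat nth_cat hj eqxx ltn_addr.
- move=> rs A IH Xi Xi' /= /and4P[-> hA -> ->]; rewrite eqxx !andbT /=.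
  by rewrite -[rev rs]cats0 IH.
- by move=> rs Ks /hK{}hK Xi Xi' /= /andP[-> h];
  rewrite eqxx andbT (hK (_ :: _)).
- by move=> rs Ks /hK{}hK Xi Xi' /= /andP[-> h];
  rewrite eqxx andbT (hK (_ :: _)).
- move=> rs As ts hAs Xi Xi' ar /= /and4P[-> h -> ->]; rewrite !andbT /=.
  elim: hAs h => //= A {}As hA _ IH /andP[/andP[wA ->] /IH->].
  by rewrite !andbT -[rev rs]cats0 hA.
Qed.

Lemma wf_form_fclose A De x : wf_ty 0 x.2 ->
  wf_form [::] De A -> wf_form [::] (rcons De x.2) (fclose (size De) x A).
Proof.
move=> hx; elim: A De => [p ts|A IHA B IHB|A IHA B IHB|A IHA B IHB
  |r A IH|r A IH] De //=.
- by move=> /andP[-> ]; apply: typed_as_map => t r; apply: tyof_tclose.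
- by move=> /andP[/IHA-> /IHB->].
- by move=> /andP[/IHA-> /IHB->].
- by move=> /andP[/IHA-> /IHB->].
- by move=> /andP[-> /IH].
- by move=> /andP[-> /IH].
Qed.

Lemma finst_fclose A Xi De x : wf_form Xi De A ->
  finst (size De) [:: FVar x] (fclose (size De) x A) = A.
Proof.
elim: A Xi De => [p ts|A IHA B IHB|A IHA B IHB|A IHA B IHB
  |r A IH|r A IH] Xi De //=.
- by move=> /andP[_ /typed_as_tinst_tclose->].
- by move=> /andP[/IHA-> /IHB->].
- by move=> /andP[/IHA-> /IHB->].
- by move=> /andP[/IHA-> /IHB->].
- by move=> /andP[_ /IH/= ->].
- by move=> /andP[_ /IH/= ->].
Qed.

Lemma wf_form_fvar A Xi De x : wf_form Xi De A -> x \in fv A -> wf_ty 0 x.2.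
Proof.
elim: A Xi De => [p ts|A IHA B IHB|A IHA B IHB|A IHA B IHB
  |r A IH|r A IH] Xi De /=.
- by move=> /andP[_ /typed_as_wf_fvar]; apply.
- by move=> /andP[/IHA hA /IHB hB]; rewrite mem_cat => /orP[].
- by move=> /andP[/IHA hA /IHB hB]; rewrite mem_cat => /orP[].
- by move=> /andP[/IHA hA /IHB hB]; rewrite mem_cat => /orP[].
- by move=> /andP[_ /IH].
- by move=> /andP[_ /IH].
Qed.

Lemma fv_fclose k x A : fv (fclose k x A) = [seq y <- fv A | y != x].
Proof.
elim: A k => [p ts|A IHA B IHB|A IHA B IHB|A IHA B IHB|r A IH|r A IH] k //=;
  rewrite ?IHA ?IHB ?filter_cat //.
elim: ts => //= t ts; rewrite /tsfv /= filter_cat tfv_tclose => <- //.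
Qed.

Lemma fv_AllV x A : fv (AllV x A) = [seq y <- fv A | y != x].
Proof. exact: fv_fclose. Qed.

Lemma wf_AllV x A : wf_ty 0 x.2 -> wf A -> wf (AllV x A).
Proof. by move=> hx hA; rewrite /wf /= hx; apply: (@wf_form_fclose A [::]). Qed.

Lemma wf_ExV x A : wf_ty 0 x.2 -> wf A -> wf (ExV x A).
Proof. by move=> hx hA; rewrite /wf /= hx; apply: (@wf_form_fclose A [::]). Qed.

Lemma wf_Imp_eq A B : wf (Imp A B) = wf A && wf B.
Proof. by []. Qed.

Lemma wf_Imps As B : List.Forall (fun A => wf A) As -> wf B -> wf (Imps As B).
Proof. by move=> hAs hB; elim: hAs => //= A {}As hA _ hI; apply/andP. Qed.

Lemma wf_Leib Xi De r (t s : tm S) : wf_ty 0 r ->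
  tyof De t = Some r -> tyof De s = Some r -> wf_form Xi De (Leib r t s).
Proof.
move=> hr ht hs; rewrite /Leib /Leibp /= hr /= /typed_as /= ht hs /=.
by rewrite !eqxx.
Qed.

Lemma wf_Bot Xi De : wf_form Xi De (@Bot S).
Proof. exact: wf_Leib. Qed.

Lemma wf_Neg A : wf (Neg A) = wf A.
Proof. by rewrite -[LHS]/(wf A && wf_form [::] [::] Bot) wf_Bot andbT. Qed.

(** Premises of clauses have to be free of named variables as well; carrying
    both demands together lets them pass through the connectives at once. *)
Definition wf_nofv Xi De A : bool := wf_form Xi De A && nilp (fv A).

Lemma wf_nofv_Conj Xi De As : all (wf_nofv Xi De) As -> wf_nofv Xi De (Conj As).
Proof.
elim: As => [|A [|A' As] IH]; first by [].
  by move=> /= /andP[].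
move=> /andP[/andP[wA fA] /IH /andP[wAs fAs]].
rewrite /wf_nofv; change (Conj _) with (And A (Conj (A' :: As))).
by rewrite /= cat_nilp wA fA; apply/andP.
Qed.

Lemma wf_nofv_Disj Xi De As : all (wf_nofv Xi De) As -> wf_nofv Xi De (Disj As).
Proof.
elim: As => [|A [|A' As] IH]; first by [].
  by move=> /= /andP[].
move=> /andP[/andP[wA fA] /IH /andP[wAs fAs]].
rewrite /wf_nofv; change (Disj _) with (Or A (Disj (A' :: As))).
by rewrite /= cat_nilp wA fA; apply/andP.
Qed.

Lemma wf_nofv_Leibs Xi De rs ts ss : all (wf_ty 0) rs ->
  typed_as De ts rs -> typed_as De ss rs ->
  nilp (tsfv ts) -> nilp (tsfv ss) -> wf_nofv Xi De (Leibs rs ts ss).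
Proof.
move=> hrs ht hs ft fs; apply: wf_nofv_Conj.
elim: rs ts ss hrs ht hs ft fs => [|r rs IH] [|t ts] [|s ss] //=.
rewrite !typed_as_cons /tsfv /= !cat_nilp.
move=> /andP[hr hrs] /andP[/eqP et ht] /andP[/eqP es hs].
move=> /andP[ft fts] /andP[fs fss].
by rewrite IH // andbT /wf_nofv wf_Leib //= !cat_nilp ft fs.
Qed.

Lemma wf_nofv_Alls Xi De rs A : all (wf_ty 0) rs ->
  wf_nofv Xi (rev rs ++ De) A -> wf_nofv Xi De (Alls rs A).
Proof.
elim: rs De => //= r rs IH De /andP[hr hrs] hA.
rewrite /wf_nofv /= hr; apply: (IH (r :: De)) => //.
by rewrite rev_cons cat_rcons in hA.
Qed.

(** * Strong negation *)

Lemma fv_sneg A : fv (sneg A) = fv A.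
Proof. by elim: A => //= [A _ B ->|A -> B ->|A -> B ->]. Qed.

(** A comprehension must use all its bound variables, hence strong negation
    may not lose any of them. *)
Lemma focc_sneg k A : focc k (sneg A) = focc k A.
Proof.
by elim: A k => //= [A IHA B IHB|A IHA B IHB|A IHA B IHB] k;
  rewrite ?IHA IHB.
Qed.

Lemma sneg_fclose k x A : sneg (fclose k x A) = fclose k x (sneg A).
Proof.
elim: A k => //= [A IHA B IHB|A IHA B IHB|A IHA B IHB|r A IH|r A IH] k;
  by rewrite ?IHA ?IHB ?IH.
Qed.

(** For an inductive or coinductive predicate the dual has a single clause
    whose premise is the conjunction E of the dualised clauses.  The variables
    ys of E are bound outside the variables xs of an original clause, so its
    premises, checked below xs alone, are weakened to the context of xs and ys.
    For an implication the weakening concerns predicate indices: the premise,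
    checked without any, becomes a conjunct. *)
Lemma wf_form_sneg A Xi De : wf_form Xi De A -> wf_form Xi De (sneg A).
Proof.
move: A Xi De.
pose P A := forall Xi De, @wf_form S Xi De A -> wf_form Xi De (sneg A).
pose Q p := forall Xi, @wf_pred S Xi p ->
  wf_pred Xi (psneg p) && (arity Xi (psneg p) == arity Xi p).
pose R c := forall Xi ar, all (wf_ty 0) ar -> @wf_clause S Xi ar c ->
  wf_nofv Xi (rev ar) (csneg ar c).
have hK Ks : List.Forall R Ks -> forall Xi rs, all (wf_ty 0) rs ->
    all (wf_clause (rs :: Xi) rs) Ks ->
    wf_clause (rs :: Xi) rs
      (Clause rs [:: Conj (map (csneg rs) Ks)] (bvars 0 (size rs))).
  move=> hR Xi rs hrs hKs.
  rewrite /= hrs tsfv_bvars (@typed_as_bvars [::]) !andbT.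
  rewrite -/(wf_nofv _ _ _).
  apply: wf_nofv_Conj; elim: hR hKs => //= c {}Ks hc _ IH /andP[/hc-> //].
apply: (@form_nested_ind S P Q R); rewrite {}/P {}/Q.
- move=> p ts IH Xi De /= /andP[/IH/andP[-> /eqP->] //].
- move=> A B IHA IHB Xi De /= /andP[hA /IHB->]; rewrite andbT.
  by rewrite -[De]cats0; apply: (@wf_form_weak _ [::]).
- by move=> A B IHA IHB Xi De /= /andP[/IHA-> /IHB->].
- by move=> A B IHA IHB Xi De /= /andP[/IHA-> /IHB->].
- by move=> r A IH Xi De /= /andP[-> /IH->].
- by move=> r A IH Xi De /= /andP[-> /IH->].
- by move=> X Xi /= ->; rewrite eqxx.
- by move=> j Xi /= ->; rewrite eqxx.
- move=> rs A IH Xi /= /and4P[-> /IH-> fA oA]; rewrite eqxx fv_sneg fA andbT /=.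
  by under eq_all => j do rewrite focc_sneg.
- move=> rs Ks /hK{}hK Xi /= /andP[hrs /(hK _ _ hrs) h].
  by rewrite eqxx hrs; move: h => /= /and4P[_ -> -> ->].
- move=> rs Ks /hK{}hK Xi /= /andP[hrs /(hK _ _ hrs) h].
  by rewrite eqxx hrs; move: h => /= /and4P[_ -> -> ->].
- move=> rs As ts hAs Xi ar har /= /and4P[hrs h ht ft].
  apply: wf_nofv_Alls => //.
  have /andP[wL fL] : wf_nofv [::] (rev rs ++ rev ar)
      (Leibs ar (bvars (size rs) (size ar)) ts).
    apply: wf_nofv_Leibs => //.
    + by rewrite -(size_rev rs) typed_as_bvars.
    + exact: typed_as_weak.
    + by rewrite tsfv_bvars.
  suff /andP[wD fD] : wf_nofv Xi (rev rs ++ rev ar) (Disj (map sneg As)).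
    by rewrite /wf_nofv /= wL wD cat_nilp fL fD.
  apply: wf_nofv_Disj; elim: hAs h => //= A {}As hA _ IH.
  move=> /andP[/andP[/hA wA fA] /IH->].
  by rewrite /wf_nofv fv_sneg fA -[Xi]cats0 wf_form_weak.
Qed.

Lemma wf_sneg A : wf A -> wf (sneg A).
Proof. exact: wf_form_sneg. Qed.

(** * Derivations *)

Lemma In_catrev (T : Type) (s u : seq T) (x : T) :
  List.In x (catrev s u) <-> List.In x s \/ List.In x u.
Proof.
by elim: s u => [|y s IH] u /=; [|rewrite IH /=]; intuition.
Qed.

Lemma deriv_Imps_intro As Ga B : List.Forall (fun A => wf A) As ->
  deriv (catrev As Ga) B -> deriv Ga (Imps As B).
Proof.
move=> hAs; elim: hAs Ga => //= A {}As hA _ IH Ga hB.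
by apply: d_impI => //; apply: IH.
Qed.

Lemma deriv_Imps_elim As Ga B :
  deriv Ga (Imps As B) -> List.Forall (deriv Ga) As -> deriv Ga B.
Proof.
by move=> hB hAs; elim: hAs hB => //= A {}As hA _ IH hI; apply/IH/(d_impE hI).
Qed.

Lemma deriv_andI Ga A B : wf A -> wf B ->
  deriv Ga A -> deriv Ga B -> deriv Ga (And A B).
Proof.
move=> wA wB hA hB; apply: d_impE hB; apply: d_impE hA.
by apply: d_axiom; [constructor|rewrite /wf /= -!/(wf _) wA wB].
Qed.

Lemma deriv_andEl Ga A B : wf A -> wf B -> deriv Ga (And A B) -> deriv Ga A.
Proof.
move=> wA wB; apply: d_impE.
by apply: d_axiom; [constructor|rewrite /wf /= -!/(wf _) wA wB].
Qed.

Lemma deriv_andEr Ga A B : wf A -> wf B -> deriv Ga (And A B) -> deriv Ga B.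
Proof.
move=> wA wB; apply: d_impE.
by apply: d_axiom; [constructor|rewrite /wf /= -!/(wf _) wA wB].
Qed.

Lemma deriv_orIl Ga A B : wf A -> wf B -> deriv Ga A -> deriv Ga (Or A B).
Proof.
move=> wA wB; apply: d_impE.
by apply: d_axiom; [constructor|rewrite /wf /= -!/(wf _) wA wB].
Qed.

Lemma deriv_orIr Ga A B : wf A -> wf B -> deriv Ga B -> deriv Ga (Or A B).
Proof.
move=> wA wB; apply: d_impE.
by apply: d_axiom; [constructor|rewrite /wf /= -!/(wf _) wA wB].
Qed.

(** Instantiating a quantifier by its own variable undoes the closing. *)
Lemma deriv_AllV_elim Ga x A :
  wf_ty 0 x.2 -> wf A -> deriv Ga (AllV x A) -> deriv Ga A.
Proof.
move=> hx wA hA; rewrite -(finst_fclose x wA).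
by apply: d_allE hA _; rewrite /= hx.
Qed.

Lemma deriv_ExV_intro Ga x A :
  wf_ty 0 x.2 -> wf A -> deriv Ga A -> deriv Ga (ExV x A).
Proof.
move=> hx wA; have wI : wf (Imp A (ExV x A)).
  by have := wf_ExV hx wA; rewrite /wf /= => ->; rewrite andbT.
apply: d_impE; apply: (deriv_AllV_elim hx wI).
by apply: d_axiom; [constructor|apply: wf_AllV].
Qed.

Lemma wf_foldr_AllV xs A :
  {in xs, forall x, wf_ty 0 x.2} -> wf A -> wf (foldr (@AllV S) A xs).
Proof.
move=> + wA; elim: xs => //= x xs IH hxs; apply: wf_AllV.
  by apply: hxs; rewrite mem_head.
by apply: IH => y hy; apply: hxs; rewrite inE hy orbT.
Qed.

Lemma deriv_foldr_AllV xs A : {in xs, forall x, wf_ty 0 x.2} -> wf A ->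
  deriv [::] (foldr (@AllV S) A xs) <-> deriv [::] A.
Proof.
move=> + wA; elim: xs => //= x xs IH hxs.
have hx : wf_ty 0 x.2 by apply: hxs; rewrite mem_head.
have hxs' : {in xs, forall x, wf_ty 0 x.2}.
  by move=> y hy; apply: hxs; rewrite inE hy orbT.
rewrite -(IH hxs'); split; last by apply: d_allI.
by apply: deriv_AllV_elim => //; apply: wf_foldr_AllV.
Qed.

(** * Tightness *)

(** The matrix of the sentence whose derivability defines tightness. *)
Definition tight_body Cs F : form S := Imps Cs (Imp (Neg (sneg F)) F).

Lemma only_free_wf xs (Cs : seq (form S)) :
  List.Forall2 (@only_free S) xs Cs -> List.Forall (fun C => wf C) Cs.
Proof. by elim=> // x C {}xs {}Cs [wC _] _ h; constructor. Qed.

Lemma only_free_fresh xs (Cs : seq (form S)) y C :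
  List.Forall2 (@only_free S) xs Cs -> y \notin xs -> List.In C Cs ->
  y \notin fv C.
Proof.
elim=> // x C' {}xs {}Cs [_ fC] _ IH.
rewrite inE negb_or => /andP[yx /IH{}IH] /= [<-|//].
by rewrite fC inE.
Qed.

Lemma wf_tight_body Cs F :
  List.Forall (fun C => wf C) Cs -> wf F -> wf (tight_body Cs F).
Proof.
move=> hCs wF; apply: wf_Imps => //.
by rewrite wf_Imp_eq wf_Neg wf_sneg.
Qed.

Lemma tight_deriv xs Cs F : tight xs Cs F -> deriv [::] (tight_body Cs F).
Proof.
move=> [wF _ fF hCs h]; apply/(deriv_foldr_AllV (xs := xs)) => //.
  by move=> x; rewrite -fF; apply: wf_form_fvar wF.
by apply: wf_tight_body => //; apply: only_free_wf hCs.
Qed.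

(** Derivable formulas [Hs] may be used as hypotheses by a cut.  They are
    in the list from the start, so no derivation has to be weakened. *)
Lemma tight_intro xs Cs F Hs : wf F -> uniq xs -> 0 < size xs -> fv F =i xs ->
  List.Forall2 (@only_free S) xs Cs ->
  List.Forall (fun H => wf H /\ deriv [::] H) Hs ->
  deriv (Neg (sneg F) :: catrev Cs (catrev Hs [::])) F -> tight xs Cs F.
Proof.
move=> wF uxs xs0 fF hCs hHs hF; split=> //.
apply/deriv_foldr_AllV.
- by move=> x; rewrite -fF; apply: wf_form_fvar wF.
- by apply: wf_tight_body => //; apply: only_free_wf hCs.
apply: (@deriv_Imps_elim Hs); last by apply: List.Forall_impl hHs => H [].
apply: deriv_Imps_intro; first by apply: List.Forall_impl hHs => H [].
apply: deriv_Imps_intro; first exact: only_free_wf hCs.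
by apply: d_impI hF; rewrite wf_Neg wf_sneg.
Qed.

(** The step common to all connectives: if Z is refutable and F^N implies Z,
    then F^N is refutable, so tightness gives F under the conditions [Cs]. *)
Lemma deriv_by_tightness Ga Cs F Z : wf F -> wf Z ->
  deriv Ga (tight_body Cs F) ->
  List.Forall (deriv Ga) Cs -> List.In (Neg Z) Ga ->
  deriv (sneg F :: Ga) Z -> deriv Ga F.
Proof.
move=> wF wZ hT hCs inZ hZ; apply: d_impE (deriv_Imps_elim hT hCs) _.
apply: d_impI; first exact: wf_sneg.
by apply: d_impE hZ; apply: d_hyp; [right|rewrite wf_Neg].
Qed.

Lemma deriv_hyps Ga As : List.Forall (fun A => wf A) As ->
  (forall A, List.In A As -> List.In A Ga) -> List.Forall (deriv Ga) As.
Proof.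
move=> hAs; elim: hAs => // A {}As wA _ IH sub; constructor.
  by apply: d_hyp => //; apply: sub; left.
by apply: IH => B hB; apply: sub; right.
Qed.

(** As a hypothesis, the tightness of A with y free would block the
    generalisation over y; its closure over y does not. *)
Lemma tight_AllV_Imp A D xs y Cs : uniq (rcons xs y) -> 0 < size xs ->
  List.Forall2 (@only_free S) xs Cs -> only_free y D ->
  tight (rcons xs y) (rcons Cs D) A -> tight xs Cs (AllV y (Imp D A)).
Proof.
rewrite rcons_uniq => /andP[ynxs uxs] xs0 hCs [wD fD] tA.
have dA := tight_deriv tA; case: tA => wA _ fA _ _.
have hy : wf_ty 0 y.2.
  by apply: (wf_form_fvar wA); rewrite fA mem_rcons mem_head.
have wDA : wf (Imp D A) by apply/andP.
have wB := wf_tight_body (only_free_wf hCs) (wf_AllV hy wDA).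
have wsDA : wf (And D (sneg A)) by apply/andP; split=> //; apply: wf_sneg.
have wT : wf (tight_body (rcons Cs D) A).
  apply: wf_tight_body => //; rewrite -cats1; apply/List.Forall_app.
  by split; [apply: only_free_wf hCs|constructor].
have sF : sneg (AllV y (Imp D A)) = ExV y (And D (sneg A)).
  by rewrite /AllV /= sneg_fclose.
have fF : fv (AllV y (Imp D A)) =i xs.
  move=> z; rewrite fv_AllV mem_filter mem_cat fD fA mem_rcons !inE.
  by case: eqVneq => //= ->; rewrite (negPf ynxs).
apply: (@tight_intro _ _ _ [:: AllV y (tight_body (rcons Cs D) A)]) => //.
- exact: wf_AllV.
- constructor=> //; split; first exact: wf_AllV.
  by apply: d_allI.
apply: d_allI => //.
  (* The eigenvariable condition for y. *)
  move=> B /= [<-|/In_catrev[]].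
  - by rewrite /= cats0 !fv_sneg fF.
  - exact: only_free_fresh hCs ynxs.
  - by case=> // <-; rewrite fv_AllV mem_filter eqxx.
apply: d_impI => //; set Ga := D :: _.
have inGa C : List.In C (rcons Cs D) -> List.In C Ga.
  rewrite -cats1 => /List.in_app_iff[hC|[<-|//]]; last by left.
  by right; right; apply/In_catrev; left.
apply: (@deriv_by_tightness _ (rcons Cs D) _ (ExV y (And D (sneg A)))) => //.
- exact: wf_ExV.
- apply: (deriv_AllV_elim hy wT); apply: d_hyp; last exact: wf_AllV.
  by right; right; apply/In_catrev; right; left.
- apply: deriv_hyps inGa; rewrite -cats1; apply/List.Forall_app.
  by split; [apply: only_free_wf hCs|constructor].
- by right; left; rewrite sF.
- apply: deriv_ExV_intro => //; apply: deriv_andI => //; first exact: wf_sneg.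
    by apply: d_hyp => //; right; left.
  by apply: d_hyp; [left|apply: wf_sneg].
Qed.

Lemma tight_Imp A B xs ys Ds : wf A -> uniq xs ->
  (forall x, (x \in xs) = (x \in fv A) && (x \notin fv B)) ->
  tight ys Ds B ->
  tight (ys ++ xs) (Ds ++ [seq Leib x.2 (FVar x) (FVar x) | x <- xs])
    (Imp A B).
Proof.
move=> wA uxs hxs tB; have dB := tight_deriv tB.
case: tB => wB [uys ys0] fB hDs _.
have wDs := only_free_wf hDs; have wT := wf_tight_body wDs wB.
have wsB := wf_sneg wB.
apply: (@tight_intro _ _ _ [:: tight_body Ds B]).
- exact/andP.
- rewrite cat_uniq uys uxs andbT /=; apply/hasPn => x.
  by rewrite hxs -fB => /andP[].
- by rewrite size_cat ltn_addr.
- by move=> x; rewrite /= !mem_cat hxs -fB orbC;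
  case: (x \in fv A); case: (x \in fv B).
- apply: List.Forall2_app => //.
  have : {subset xs <= fv A} by move=> x; rewrite hxs => /andP[].
  elim: xs {uxs hxs} => [|x xs IH] sub; constructor.
    have hx := wf_form_fvar wA (sub _ (mem_head _ _)).
    split; first by apply: wf_Leib; rewrite //= hx.
    by move=> y; rewrite !inE orbb.
  by apply: IH => y hy; apply: sub; rewrite inE hy orbT.
- by constructor.
apply: d_impI => //; apply: (@deriv_by_tightness _ Ds _ (And A (sneg B))) => //.
- exact/andP.
- by apply: d_hyp => //; right; right; apply/In_catrev; right; left.
- apply: deriv_hyps => // D hD; right; right; apply/In_catrev; left.
  by apply/List.in_app_iff; left.
- by right; left.
- by apply: deriv_andI => //; apply: d_hyp => //; [right; left|left].
Qed.

Lemma deriv_zip_And (Ga CAs CBs : seq (form S)) : size CAs = size CBs ->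
  List.Forall (fun C => wf C) CAs -> List.Forall (fun C => wf C) CBs ->
  List.Forall (deriv Ga) [seq And C.1 C.2 | C <- zip CAs CBs] ->
  List.Forall (deriv Ga) CAs /\ List.Forall (deriv Ga) CBs.
Proof.
elim: CAs CBs => [|A CAs IH] [|B CBs] //= [es].
move=> /List.Forall_cons_iff[wA wAs] /List.Forall_cons_iff[wB wBs].
move=> /List.Forall_cons_iff[hAB /(IH _ es wAs wBs)[hAs hBs]].
by split; constructor=> //; [apply: deriv_andEl hAB|apply: deriv_andEr hAB].
Qed.

Lemma only_free_zip_And xs CAs CBs :
  List.Forall2 (@only_free S) xs CAs -> List.Forall2 (@only_free S) xs CBs ->
  List.Forall2 (@only_free S) xs [seq And C.1 C.2 | C <- zip CAs CBs].
Proof.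
move=> hA; elim: hA CBs => [|x A {}xs {}CAs [wA fA] _ IH] CBs hB;
  inversion_clear hB => //=.
constructor; last exact: IH.
case: H => wB fB; split; first exact/andP.
by move=> z; rewrite mem_cat fA fB orbb.
Qed.

Lemma tight_And A B xs ys zs CAs CBs DAs DBs :
  uniq (xs ++ ys ++ zs) ->
  List.Forall2 (@only_free S) xs CAs -> List.Forall2 (@only_free S) ys DAs ->
  List.Forall2 (@only_free S) xs CBs -> List.Forall2 (@only_free S) zs DBs ->
  tight (xs ++ ys) (CAs ++ DAs) A -> tight (xs ++ zs) (CBs ++ DBs) B ->
  tight (xs ++ ys ++ zs)
    ([seq And C.1 C.2 | C <- zip CAs CBs] ++ DAs ++ DBs) (And A B).
Proof.
move=> uxs hCA hDA hCB hDB tA tB.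
have [dA dB] := (tight_deriv tA, tight_deriv tB).
case: tA => wA [_ s0] fA /only_free_wf wCDA _.
case: tB => wB _ fB /only_free_wf wCDB _.
have [wTA wTB] := (wf_tight_body wCDA wA, wf_tight_body wCDB wB).
have [wsA wsB] := (wf_sneg wA, wf_sneg wB).
have hC := only_free_zip_And hCA hCB.
have wOr : wf (Or (sneg A) (sneg B)) by apply/andP.
apply: (@tight_intro _ _ _
  [:: tight_body (CAs ++ DAs) A; tight_body (CBs ++ DBs) B]).
- exact/andP.
- by [].
- by rewrite catA size_cat ltn_addr.
- move=> x; rewrite /= !mem_cat fA fB !mem_cat.
  by case: (x \in xs); case: (x \in ys); case: (x \in zs).
- by do 2![apply: List.Forall2_app => //].
- by do 2!constructor.
set Ga := Neg _ :: _.
have inGa C : List.In C ([seq And C.1 C.2 | C <- zip CAs CBs] ++ DAs ++ DBs) ->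
    List.In C Ga.
  by move=> h; right; apply/In_catrev; left.
have [eA eB] : size CAs = size xs /\ size CBs = size xs.
  by split; symmetry;
  [apply: List.Forall2_length hCA|apply: List.Forall2_length hCB].
have [hCAs hCBs] : List.Forall (deriv Ga) CAs /\ List.Forall (deriv Ga) CBs.
  apply: deriv_zip_And; rewrite ?eA ?eB //.
  - exact: only_free_wf hCA.
  - exact: only_free_wf hCB.
  - apply: deriv_hyps; first exact: only_free_wf hC.
    by move=> C h; apply/inGa/List.in_app_iff; left.
have hDAs : List.Forall (deriv Ga) DAs.
  apply: deriv_hyps; first exact: only_free_wf hDA.
  by move=> C h; apply: inGa; rewrite !List.in_app_iff; tauto.
have hDBs : List.Forall (deriv Ga) DBs.
  apply: deriv_hyps; first exact: only_free_wf hDB.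
  by move=> C h; apply: inGa; rewrite !List.in_app_iff; tauto.
apply: deriv_andI => //.
- apply: (deriv_by_tightness (Cs := CAs ++ DAs)
    (Z := Or (sneg A) (sneg B))) => //.
  + by apply: d_hyp => //; right; apply/In_catrev; right; right; left.
  + exact/List.Forall_app.
  + by left.
  + by apply: deriv_orIl => //; apply: d_hyp => //; left.
- apply: (deriv_by_tightness (Cs := CBs ++ DBs)
    (Z := Or (sneg A) (sneg B))) => //.
  + by apply: d_hyp => //; right; apply/In_catrev; right; left.
  + exact/List.Forall_app.
  + by left.
  + by apply: deriv_orIr => //; apply: d_hyp => //; left.
Qed.

End RelativeTightness.

Theorem lemma5p6 (S : signature) (hS : wf_signature S) :
  (* (1) *)
  (forall (A D : form S) (xs : seq var) (y : var) (Cs : seq (form S)),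
     wf A -> uniq (rcons xs y) -> 0 < size xs -> fv A =i rcons xs y ->
     List.Forall2 (@only_free S) xs Cs -> only_free y D ->
     tight (rcons xs y) (rcons Cs D) A ->
     tight xs Cs (AllV y (Imp D A)))
  /\
  (* (2) *)
  (forall (A B : form S) (xs ys : seq var) (Ds : seq (form S)),
     wf A -> wf B -> uniq ys -> fv B =i ys ->
     List.Forall2 (@only_free S) ys Ds ->
     uniq xs -> (forall x, (x \in xs) = (x \in fv A) && (x \notin fv B)) ->
     tight ys Ds B ->
     tight (ys ++ xs) (Ds ++ [seq Leib x.2 (FVar x) (FVar x) | x <- xs])
       (Imp A B))
  /\
  (* (3) *)
  (forall (A B : form S) (xs ys zs : seq var) (CAs CBs DAs DBs : seq (form S)),
     wf A -> wf B -> uniq (xs ++ ys ++ zs) ->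
     fv A =i xs ++ ys -> fv B =i xs ++ zs ->
     List.Forall2 (@only_free S) xs CAs -> List.Forall2 (@only_free S) ys DAs ->
     List.Forall2 (@only_free S) xs CBs -> List.Forall2 (@only_free S) zs DBs ->
     tight (xs ++ ys) (CAs ++ DAs) A ->
     tight (xs ++ zs) (CBs ++ DBs) B ->
     tight (xs ++ ys ++ zs)
       ([seq And C.1 C.2 | C <- zip CAs CBs] ++ DAs ++ DBs) (And A B)).
Proof.
split; last split.
- by move=> A D xs y Cs _ uxs xs0 _ hCs hD; apply: tight_AllV_Imp.
- by move=> A B xs ys Ds wA _ _ _ _ uxs hxs; apply: tight_Imp.
- move=> A B xs ys zs CAs CBs DAs DBs _ _ uxs _ _ hCA hDA hCB hDB.
  exact: tight_And.
Qed.
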